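(* Let $k,n$ be positive integers, let $A\subseteq\{0,\dots,k\}^{n}$, and let $B\subseteq\{0,\dots,k\}^{n}$ be the initial segment of the order $\leq$ (defined in the context) with $|B|=|A|$. Then $|\delta A|\geq|\delta B|$.
   Context: For $A\subseteq\{0,\dots,k\}^{n}$, the $\delta$-shadow $\delta A\subseteq\{0,\dots,k\}^{n-1}$ is the set of all sequences obtained by removing one coordinate that equals $0$ from some vector of $A$. For a sequence $x$ with entries in $\{0,\dots,k\}$ and $i\in\{0,\dots,k\}$, let $R_i(x)=\{j : x_j=i\}$ and $w_i(x)=|R_i(x)|$. The reduced sequence $re(x)$ is the sequence obtained from $x$ by removing all coordinates equal to $0$ (keeping the order of the remaining ones). Colexicographic order: for sets $X,Y\subseteq[n]=\{1,\dots,n\}$ of the same size, $X\leq_{colex}Y$ if $X=Y$ or $\max(X\Delta Y)\in Y$. For each $r\ge 0$, the order $\leq_c$ on $\{1,\dots,k\}^{r}$ is defined as follows: for distinct $x,y\in\{1,\dots,k\}^{r}$ let $i$ be minimal such that $R_i(x)\neq R_i(y)$; then $x\leq_c y$ if and only if $\max(R_i(x)\Delta R_i(y))\in R_i(y)$. The order $\leq$ on $\{0,\dots,k\}^{n}$: for distinct $x,y\in\{0,\dots,k\}^{n}$, $x\leq y$ if one of the following holds: 1. $w_0(x)<w_0(y)$; 2. $w_0(x)=w_0(y)$, $re(x)\neq re(y)$ and $re(x)\leq_c re(y)$; 3. $w_0(x)=w_0(y)$, $re(x)=re(y)$ and $R_0(x)\leq_{colex}R_0(y)$. An initial segment of an order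 is a set $B$ such that $y\in B$ and $x\leq y$ imply $x\in B$. *)

(* Defs.v *)
From mathcomp Require Import all_boot.

Set Implicit Arguments.
Unset Strict Implicit.
Unset Printing Implicit Defensive.

(* Vectors of {0,..,k}^r are r.-tuple 'I_k.+1. Positions are 0-based, which
   changes neither the orders nor the shadow. *)

Definition delete_at (T : Type) (i : nat) (s : seq T) : seq T :=
  take i s ++ drop i.+1 s.

Definition shadow (k n : nat) (A : {set n.-tuple 'I_k.+1}) :
    {set n.-1.-tuple 'I_k.+1} :=
  [set y : n.-1.-tuple 'I_k.+1 |
    [exists x in A, exists i : 'I_n,
      (tnth x i == ord0) && (val y == delete_at i x)]].

Definition R (k r : nat) (i : 'I_k.+1) (x : r.-tuple 'I_k.+1) : {set 'I_r} :=
  [set j | tnth x j == i].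

Definition w (k r : nat) (i : 'I_k.+1) (x : r.-tuple 'I_k.+1) : nat :=
  #|R i x|.

Definition re (k n : nat) (x : n.-tuple 'I_k.+1) : seq 'I_k.+1 :=
  [seq a <- x | a != ord0].

Definition symdiff (T : finType) (X Y : {set T}) : {set T} :=
  (X :\: Y) :|: (Y :\: X).

(* max (X symdiff Y) exists and belongs to Y; false when X = Y. *)
Definition max_symdiff_in (r : nat) (X Y : {set 'I_r}) : bool :=
  [exists m in symdiff X Y,
    [forall j in symdiff X Y, j <= m] && (m \in Y)].

(* Only ever applied to sets of the same size. *)
Definition colex (r : nat) (X Y : {set 'I_r}) : bool :=
  (X == Y) || max_symdiff_in X Y.

(* Meant for vectors with entries in {1,..,k}; on these R ord0 is empty, so
   letting i range over {0,..,k} makes no difference. *)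
Definition le_c (k r : nat) (x y : r.-tuple 'I_k.+1) : bool :=
  (x == y) ||
  [exists i : 'I_k.+1,
    [&& R i x != R i y,
        [forall j : 'I_k.+1, (j < i) ==> (R j x == R j y)]
      & max_symdiff_in (R i x) (R i y)]].

(* le_c on the reduced sequences, viewed as tuples of their common length;
   false if the lengths differ. *)
Definition re_le_c (k n : nat) (x y : n.-tuple 'I_k.+1) : bool :=
  [exists u : (size (re x)).-tuple 'I_k.+1,
   exists v : (size (re x)).-tuple 'I_k.+1,
    [&& val u == re x, val v == re y & le_c u v]].

Definition vec_le (k n : nat) (x y : n.-tuple 'I_k.+1) : bool :=
  [|| x == y,
      w ord0 x < w ord0 y,
      [&& w ord0 x == w ord0 y, re x != re y & re_le_c x y]
    | [&& w ord0 x == w ord0 y, re x == re y & colex (R ord0 x) (R ord0 y)]].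

Definition initial_segment (T : finType) (le : rel T) (B : {set T}) : Prop :=
  forall x y : T, y \in B -> le x y -> x \in B.

(* Main.v *)
Require Import Defs.
From mathcomp Require Import all_boot zify.

(** Deleting a zero preserves the reduced sequence, so the shadow splits over
the fibres of [re]. In the fibre of a sequence of length [t], a vector with [m]
zeros is a multiset of size [m] on the [t + 1] gaps, and the shadow is the
usual multiset shadow. Listing the multisets in colex order and marking those
that bring a new element into the shadow gives 0/1 words [W m t] with
[W m t = W m (t - 1) ++ W (m - 1) t]; [minshadow m a] counts the ones among the
first [a] letters. The reversed complement of [W m t] is [W t m], and this
duality gives the subadditivity of [minshadow m] and the numerical inequality
[minshadow m (p + q) <= max q (minshadow m p + minshadow (m - 1) q)]. The latter
yields the lower bound on the shadow in one fibre, by induction on the length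
after splitting the family according to the first letter. Subadditivity, the
monotonicity in [m] and the duality show that moving as many vectors as possible
to a fibre with fewer zeros does not increase the sum of the minimal shadows,
so filling the fibres greedily is optimal. *)

Set Implicit Arguments.
Unset Strict Implicit.
Unset Printing Implicit Defensive.

(** * The minimal shadow function *)

(** The recursion lowers either [m] or [t], hence the nested fixpoint. With [m = 0] there is no zero
    to delete, so the only word adds nothing to the shadow; with [t = 0] and [m] positive the only
    word is constant zero and adds one element. *)
Fixpoint colex_word (m t : nat) {struct m} : seq bool :=
  if m is m'.+1 then
    (fix col t := if t is t'.+1 then col t' ++ colex_word m' t else [:: true]) t
  else [:: false].

Lemma colex_wordS m t :
  colex_word m.+1 t.+1 = colex_word m.+1 t ++ colex_word m t.+1.
Proof. by []. Qed.

(** The number of words with [m] zeros and a prescribed reduced sequence of length [t], that is, of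
    multisets of size [m] on [t + 1] gaps. *)
Definition nwords (m t : nat) := 'C(m + t, t).

Lemma nwordsS m t : nwords m.+1 t.+1 = nwords m.+1 t + nwords m t.+1.
Proof. by rewrite /nwords addnS binS addnC !addnS !addSn. Qed.

Lemma nwords0 m : nwords m 0 = 1. Proof. by rewrite /nwords bin0. Qed.
Lemma nwords0l t : nwords 0 t = 1. Proof. by rewrite /nwords add0n binn. Qed.

Lemma nwordsC m t : nwords m t = nwords t m.
Proof. by rewrite /nwords (addnC t) -[in LHS]bin_sub ?leq_addl // addnK. Qed.

Lemma nwords_gt0 m t : 0 < nwords m t.
Proof. by rewrite bin_gt0 leq_addl. Qed.

Lemma size_colex_word m t : size (colex_word m t) = nwords m t.
Proof.
elim: m t => [|m IHm] t; first by rewrite nwords0l.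
elim: t => [|t IHt]; first by rewrite nwords0.
by rewrite colex_wordS size_cat IHt IHm nwordsS.
Qed.

Lemma count_colex_word m t : count id (colex_word m.+1 t) = nwords m t.
Proof.
elim: m t => [|m IHm]; elim=> [|t IHt] //; rewrite ?nwords0 //.
  by rewrite colex_wordS count_cat IHt !nwords0l.
by rewrite colex_wordS count_cat IHt IHm nwordsS.
Qed.

(** Reversal swaps the two blocks of the recursion, and so does exchanging [m] and [t]. For
    [m = t = 0] both words are [[:: false]] and complementation fails. *)
Lemma colex_word_dual m t :
  0 < m + t -> map negb (rev (colex_word m t)) = colex_word t m.
Proof.
elim: m t => [|m IHm]; first by case.
elim=> [|t IHt] _ //.
by rewrite !colex_wordS rev_cat map_cat IHm ?addnS // IHt.
Qed.

Lemma take_colex_wordS m t a :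
  a <= nwords m t -> take a (colex_word m t.+1) = take a (colex_word m t).
Proof. by case: m => // m ha; rewrite colex_wordS takel_cat ?size_colex_word. Qed.

Lemma take_colex_word m t d a :
  a <= nwords m t -> take a (colex_word m (t + d)) = take a (colex_word m t).
Proof.
move=> ha; elim: d => [|d IHd]; rewrite ?addn0 // addnS take_colex_wordS //.
apply: leq_trans ha _; elim: {IHd} d => [|d IHd]; rewrite ?addn0 //.
by apply: leq_trans IHd _; rewrite addnS; case: m => [|m]; rewrite ?nwords0l // nwordsS leq_addr.
Qed.

Lemma ltn_nwords m t : t < nwords m.+1 t.
Proof.
elim: t => [|t IHt]; first exact: nwords_gt0.
by rewrite nwordsS; have := nwords_gt0 m t.+1; lia.
Qed.

(** For positive [m] the value [t = a] makes the word long enough, and by prefix stability any other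
    long enough [t] gives the same count. For [m = 0] the count is always zero. *)
Definition minshadow (m a : nat) := count id (take a (colex_word m a)).

Lemma minshadow0 m : minshadow m 0 = 0. Proof. by rewrite /minshadow take0. Qed.

Lemma minshadow0l a : minshadow 0 a = 0. Proof. by case: a => [|[|a]]. Qed.

Lemma minshadowE m t a :
  a <= nwords m t -> minshadow m a = count id (take a (colex_word m t)).
Proof.
case: m => [|m] ha; first by rewrite minshadow0l; case: a {ha} => [|[|a]].
have ha' := ltnW (ltn_nwords m a); rewrite /minshadow.
case: (leqP a t) => h.
  by rewrite -(subnKC h) take_colex_word.
by have := @take_colex_word m.+1 t (a - t) a ha; rewrite (subnKC (ltnW h)) => ->.
Qed.

Lemma minshadow_full m t : minshadow m.+1 (nwords m.+1 t) = nwords m t.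
Proof. by rewrite (minshadowE (leqnn _)) -size_colex_word take_size count_colex_word. Qed.

Lemma minshadowD m t a : a <= nwords m t.+1 ->
  minshadow m.+1 (nwords m.+1 t + a) = nwords m t + minshadow m a.
Proof.
move=> ha; rewrite (@minshadowE _ t.+1) ?nwordsS ?leq_add2l //.
rewrite colex_wordS take_cat size_colex_word ltnNge leq_addr addKn count_cat.
by rewrite count_colex_word -minshadowE.
Qed.

(* The last [c] letters of [colex_word m t] are, up to complement and reversal,
   the first [c] letters of [colex_word t m]. *)
Lemma minshadow_dual m t c : 0 < m + t -> c <= nwords m t ->
  minshadow m (nwords m t - c) + c = minshadow m (nwords m t) + minshadow t c.
Proof.
move=> mt hc.
rewrite (@minshadowE m t) ?leq_subr // (@minshadowE m t) // (@minshadowE t m) ?(nwordsC t) //.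
rewrite -(colex_word_dual mt) -map_take take_rev map_rev count_rev count_map.
rewrite -size_colex_word take_size; set w := colex_word m t.
have hs : size (drop (size w - c) w) = c by rewrite size_drop subKn // size_colex_word.
have e1 : count id w = count id (take (size w - c) w) + count id (drop (size w - c) w).
  by rewrite -count_cat cat_take_drop.
rewrite e1 -addnA; congr (_ + _).
by rewrite -[LHS]hs -(count_predC id).
Qed.

Lemma minshadow_le m a : minshadow m a <= a.
Proof.
by rewrite /minshadow (leq_trans (count_size _ _)) // size_take_min geq_minl.
Qed.

Lemma nwords_bound m a : exists t, a <= nwords m.+1 t.
Proof. by exists a; apply/ltnW/ltn_nwords. Qed.

Lemma minshadow_mono m a b : a <= b -> minshadow m a <= minshadow m b.
Proof.
move=> ab; case: m => [|m]; first by rewrite !minshadow0l.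
have [t hb] := nwords_bound m b.
rewrite (minshadowE hb) (minshadowE (leq_trans ab hb)) -(subnKC ab) takeD.
by rewrite count_cat leq_addr.
Qed.

(** * Subadditivity, and monotonicity in the number of zeros *)

Lemma minshadow1 m : minshadow m.+1 1 = 1.
Proof. by have := minshadow_full m 0; rewrite !nwords0. Qed.

(** Beyond the first block of the word for [m.+1] both sides count the rest by [minshadow m], and
    subadditivity separates the two pieces on the left. Subadditivity is a bounded hypothesis
    because the lemma is called inside the induction that proves it. *)
Lemma minshadowS_of_subadd m T c :
  (forall a b, a + b <= nwords m T -> minshadow m (a + b) <= minshadow m a + minshadow m b) ->
  c <= nwords m T -> minshadow m c <= minshadow m.+1 c.
Proof.
move=> subadd; have [t] := nwords_bound m c.
elim: t c => [|t IHt] c hc hT.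
  by case: c hc {hT} => [|[|c]]; rewrite ?nwords0 ?minshadow0 // minshadow1 minshadow_le.
have [h|h] := leqP c (nwords m.+1 t); first exact: IHt.
have hL := IHt _ (leqnn _) (leq_trans (ltnW h) hT).
rewrite -(subnKC (ltnW h)) minshadowD; last by move: hc; rewrite nwordsS; lia.
rewrite minshadow_full in hL.
apply: leq_trans (subadd _ _ _) _; first by rewrite subnKC // ltnW.
by rewrite leq_add2r.
Qed.

Lemma minshadow_subadd_bounded m t a b : a + b <= nwords m t ->
  minshadow m (a + b) <= minshadow m a + minshadow m b.
Proof.
have [N] := ubnP (m + t); elim: N => // N IHN in m t a b *.
case: m => [|m] hN; first by rewrite !minshadow0l.
case: t hN => [|t] hN.
  by rewrite nwords0; case: a => [|[|a]] //; case: b => [|b] //; rewrite addn0 leq_addr.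
have [h _|h hab] := leqP (a + b) (nwords m.+1 t); first by apply: (IHN _ t) => //; lia.
have P1 a' b' : a' + b' <= nwords m t.+1 ->
  minshadow m (a' + b') <= minshadow m a' + minshadow m b' by apply: IHN; lia.
have P2 a' b' : a' + b' <= nwords t m.+1 ->
  minshadow t (a' + b') <= minshadow t a' + minshadow t b' by apply: IHN; lia.
have M c : c <= nwords m t.+1 -> minshadow m c <= minshadow m.+1 c.
  exact: minshadowS_of_subadd.
rewrite nwordsS in hab.
(* When one summand contains the whole first block, that block is removed from both sides and the
   induction hypothesis applies to the rest. *)
have big a' b' : nwords m.+1 t <= a' -> a' + b' = a + b ->
    minshadow m.+1 (a' + b') <= minshadow m.+1 a' + minshadow m.+1 b'.
  move=> ha' e; rewrite -(subnKC ha') -addnA !minshadowD; [|lia..].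
  rewrite -addnA leq_add2l; apply: leq_trans (P1 _ _ _) _; first by lia.
  by rewrite leq_add2l M //; lia.
have [ha|ha] := leqP (nwords m.+1 t) a; first exact: big.
have [hb|hb] := leqP (nwords m.+1 t) b.
  by rewrite addnC [X in _ <= X]addnC; apply: big; rewrite // addnC.
(* Here both summands are smaller than the first block but their sum exceeds it by [e]. The
   complements of [a] and [b] in the block add up to the complement of [e], so duality turns the
   claim into subadditivity of [minshadow t]. *)
have E : a + b = nwords m.+1 t + (a + b - nwords m.+1 t) by lia.
rewrite E minshadowD; last by lia.
set e := a + b - nwords m.+1 t in E *.
have Me : minshadow m e <= minshadow m.+1 e by apply: M; lia.
have Df := @minshadow_dual m.+1 t.
have Db := Df (nwords m.+1 t - b) isT (leq_subr _ _).
have Da := Df (nwords m.+1 t - a) isT (leq_subr _ _).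
have De := Df (nwords m.+1 t - e) isT (leq_subr _ _).
have := P2 (nwords m.+1 t - b) (nwords m.+1 t - a).
rewrite (_ : _ - _ + _ = nwords m.+1 t - e); last by lia.
rewrite (nwordsC t) leq_subr => /(_ isT).
move: Da Db De; rewrite minshadow_full !subKn; lia.
Qed.

Lemma minshadow_subadd m a b : minshadow m (a + b) <= minshadow m a + minshadow m b.
Proof.
case: m => [|m]; first by rewrite !minshadow0l.
by have [t] := nwords_bound m (a + b); apply: minshadow_subadd_bounded.
Qed.

Lemma minshadow_homo m m' c : m <= m' -> minshadow m c <= minshadow m' c.
Proof.
move=> /subnKC <-; elim: (m' - m) => [|d IHd]; rewrite ?addn0 // addnS.
apply: leq_trans IHd _; case: (m + d) => [|p]; first by rewrite minshadow0l.
have [T hT] := nwords_bound p c; apply: minshadowS_of_subadd hT => a b _.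
exact: minshadow_subadd.
Qed.

(** * The splitting and exchange inequalities *)

(** Here [p] and [q] stand for the numbers of words with a nonzero and with a zero first letter. The
    induction is on [m], then on the [t] of a word containing [p + q] letters. *)
Lemma minshadow_split m p q :
  minshadow m.+1 (p + q) <= maxn q (minshadow m.+1 p + minshadow m q).
Proof.
elim: m p q => [|m IHm] p q.
  case: q => [|q]; first by rewrite addn0 leq_max leq_addr orbT.
  rewrite leq_max; apply/orP; left.
  have [u hu] := nwords_bound 0 (p + q.+1).
  have := minshadow_mono 1 hu; rewrite minshadow_full nwords0l => h.
  exact: leq_trans h _.
have [t] := nwords_bound m.+1 (p + q).
elim: t p q => [|t IHt] p q hpq.
  rewrite nwords0 in hpq; case: q hpq => [|q] hpq.
    by rewrite addn0 leq_max leq_addr orbT.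
  by rewrite leq_max (leq_trans (minshadow_le _ _)) //; lia.
have [h|h] := leqP (p + q) (nwords m.+2 t); first exact: IHt.
(* Together with the later assumption that [q] is smaller than the left side, this bounds [q] by the
   length of the word for [m.+1] and [t.+1]. *)
have hq0 := leq_trans (minshadow_mono m.+2 hpq) (eq_leq (minshadow_full _ _)).
rewrite nwordsS in hpq.
have E : p + q = nwords m.+2 t + (p + q - nwords m.+2 t) by lia.
rewrite leq_max; have [//|/=] := leqP (minshadow m.+2 (p + q)) q.
move: hq0; rewrite E; set a := (p + q - _) in E *.
have ha : a <= nwords m.+1 t.+1 by lia.
rewrite minshadowD // => hq0 hq.
have [hp|hp] := leqP (nwords m.+2 t) p.
  rewrite -(subnKC hp) minshadowD; last by lia.
  rewrite -addnA leq_add2l (_ : a = p - nwords m.+2 t + q); last by lia.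
  exact: minshadow_subadd.
(* Now [p] falls short of the first block by [c], so [a = q - c]; duality expresses
   [minshadow m.+2 p] through [minshadow t c]. *)
set c := nwords m.+2 t - p.
have Dp : minshadow m.+2 p + c = nwords m.+1 t + minshadow t c.
  have := @minshadow_dual m.+2 t c isT (leq_subr _ _).
  by rewrite minshadow_full subKn // ltnW.
have D1 := @minshadow_dual m.+1 t.
have full1 := minshadow_full m t.
(* If [q] fits in the first block of the word for [m.+1], the complement of [a] there is the
   complement of [q] plus [c], and subadditivity of [minshadow t] suffices. *)
have [hqD|hqD] := leqP q (nwords m.+1 t).
  have Dq := D1 (nwords m.+1 t - q) isT (leq_subr _ _).
  have Da := D1 (nwords m.+1 t - a) isT (leq_subr _ _).
  have := minshadow_subadd t (nwords m.+1 t - q) c.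
  rewrite (_ : _ + c = nwords m.+1 t - a); last by lia.
  move: Da Dq; rewrite full1 !subKn //; lia.
(* Otherwise the induction hypothesis on [m] is applied to [a], with the excess of [q] over the
   block as second part. This inequality rules out the first alternative of the maximum. *)
have hqa : q - nwords m.+1 t < minshadow m.+1 a by lia.
have := minshadow_le m.+1 a => hle.
have := IHm (a - (q - nwords m.+1 t)) (q - nwords m.+1 t).
rewrite subnK; last by lia.
rewrite leq_max leqNgt hqa /=.
have -> : a - (q - nwords m.+1 t) = nwords m.+1 t - c by lia.
have Dc := D1 c isT; move: Dc; rewrite full1 => /(_ _) Dc.
have hc : c <= nwords m.+1 t by lia.
move: (Dc hc).
have := @minshadowD m t (q - nwords m.+1 t); rewrite subnKC ?(ltnW hqD) //.
rewrite nwordsS in hq0 *.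
move=> /(_ _) H; rewrite H; lia.
Qed.

(** If all [b] words fit, subadditivity and monotonicity in [m] suffice. If the first fibre becomes
    full, duality turns both changes into values at the complements, and the same two properties
    apply to [t'] and [t], where [t' <= t]. *)
Lemma minshadow_exchange m t m' t' a b :
    m + t = m' + t' -> 0 < m + t -> m <= m' ->
    a <= nwords m t -> b <= nwords m' t' ->
  let c := minn b (nwords m t - a) in
  minshadow m (a + c) + minshadow m' (b - c) <= minshadow m a + minshadow m' b.
Proof.
move=> e gt0 mm' ha hb /=; have [h|h] := leqP b (nwords m t - a).
  rewrite subnn minshadow0 addn0; apply: leq_trans (minshadow_subadd _ _ _) _.
  by rewrite leq_add2l minshadow_homo.
set c := nwords m t - a; rewrite subnKC //.
have D1 := @minshadow_dual m t c gt0 (leq_subr _ _).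
rewrite subKn // in D1.
have gt0' : 0 < m' + t' by rewrite -e.
have D2 := @minshadow_dual m' t' (nwords m' t' - b) gt0' (leq_subr _ _).
have D3 := @minshadow_dual m' t' (nwords m' t' - b + c) gt0'.
have S := minshadow_subadd t' (nwords m' t' - b) c.
have M : minshadow t' c <= minshadow t c by apply: minshadow_homo; lia.
have := D3 _; rewrite subKn // in D2.
have -> : nwords m' t' - (nwords m' t' - b + c) = b - c by lia.
lia.
Qed.

(** * Greedy filling *)

Lemma eq_of_leq_sum (I : eqType) (S : seq I) (a b : I -> nat) :
    {in S, forall i, a i <= b i} ->
    \sum_(i <- S) a i = \sum_(i <- S) b i -> {in S, a =1 b}.
Proof.
elim: S => // x s IHs hab; rewrite !big_cons => e.
have hx := hab x (mem_head _ _).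
have hs : {in s, forall i, a i <= b i} by move=> i hi; apply: hab; rewrite inE hi orbT.
have hS : \sum_(i <- s) a i <= \sum_(i <- s) b i.
  by rewrite big_seq [X in _ <= X]big_seq leq_sum.
move=> i; rewrite inE => /predU1P[->|]; first by lia.
by apply: IHs => //; lia.
Qed.

Section Greedy.

Variables (I : eqType) (S : seq I).
Hypothesis uniqS : uniq S.

Definition transfer (i j : I) (c : nat) (a : I -> nat) : I -> nat :=
  fun l => if l == i then a i + c else if l == j then a j - c else a l.

(** The old terms are added on the left to avoid truncated subtraction. The general [F] serves for
    the total size, the potential and the objective alike. *)
Lemma sum_transfer (F : I -> nat -> nat) i j c a :
    i \in S -> j \in S -> i != j ->
  \sum_(l <- S) F l (transfer i j c a l) + (F i (a i) + F j (a j)) =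
  \sum_(l <- S) F l (a l) + (F i (a i + c) + F j (a j - c)).
Proof.
move=> hi hj ij.
have D G : \sum_(l <- S) G l = G i + (G j + \sum_(l <- S | (l != i) && (l != j)) G l) :> nat.
  rewrite (bigD1_seq i) //= -big_filter (bigD1_seq j) ?filter_uniq //=.
    by rewrite big_filter_cond.
  by rewrite mem_filter [j == i]eq_sym ij.
rewrite [X in X + _ = _]D [X in _ = X + _]D /transfer !eqxx eq_sym (negPf ij).
rewrite (eq_bigr (fun l => F l (a l))); last by move=> l /andP[/negPf-> /negPf->].
lia.
Qed.

(** As long as [a] differs from [b], equal totals give an index [i] below its target and an index
    [j] above it. Moving as much as possible from [j] to [i] does not increase the objective and
    lowers the potential [cost]. *)
Lemma greedy_sum_min (f : I -> nat -> nat) (L b : I -> nat) :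
    {in S, forall i, b i <= L i} ->
    {in S &, forall i j, i != j -> 0 < b i < L i -> b j = 0 \/ b j = L j} ->
    {in S &, forall i j, i != j -> 0 < b i -> b j < L j ->
      forall x y, x <= L i -> y <= L j ->
      f i (x + minn y (L i - x)) + f j (y - minn y (L i - x)) <= f i x + f j y} ->
  forall a, {in S, forall i, a i <= L i} ->
    \sum_(i <- S) a i = \sum_(i <- S) b i ->
  \sum_(i <- S) f i (b i) <= \sum_(i <- S) f i (a i).
Proof.
move=> bL part swap a.
(* Distance from [a] to [b]; at most one [b l] is neither [0] nor [L l], and it
   need not be counted. *)
pose cost l x := if b l == 0 then x else if b l == L l then L l - x else 0.
have [N] := ubnP (\sum_(i <- S) cost i (a i)).
elim: N a => // N IHN a hN aL eab.
case: (boolP (has (fun i => a i < b i) S)) => [/hasP[i iS aib]|/hasPn hge]; last first.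
  have e : {in S, b =1 a}.
    by apply: eq_of_leq_sum => // i /hge; rewrite -leqNgt.
  by rewrite (eq_big_seq (fun i => f i (a i))) // => i /e ->.
case: (boolP (has (fun j => b j < a j) S)) => [/hasP[j jS baj]|/hasPn hge]; last first.
  have e : {in S, a =1 b}.
    by apply: eq_of_leq_sum => // j /hge; rewrite -leqNgt.
  by rewrite (eq_big_seq (fun i => f i (a i))) // => l /e ->.
have ij : i != j by apply: contraTneq aib => ->; rewrite -leqNgt ltnW.
have aLi := aL i iS; have aLj := aL j jS.
have bLi := bL i iS; have bLj := bL j jS.
have := swap i j iS jS ij (leq_ltn_trans (leq0n _) aib) (leq_trans baj aLj) _ _ aLi aLj.
set c := minn _ _ => hf.
have hc : 0 < c by rewrite /c; lia.
have hcl : c <= L i - a i by rewrite /c; lia.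
have hcj : c <= a j by rewrite /c; lia.
have hsum := @sum_transfer (fun=> id) i j c a iS jS ij.
have hcost := @sum_transfer cost i j c a iS jS ij.
have hF := @sum_transfer f i j c a iS jS ij.
have hP := part i j iS jS ij.
apply: leq_trans (IHN (transfer i j c a) _ _ _) _; last by lia.
(* Either [b i = L i] or [b j = 0], since [b i] is positive, [b j < L j] and two partial fibres are
   excluded. The corresponding cost drops by [c], and the other does not grow. *)
- have : cost i (a i + c) + cost j (a j - c) < cost i (a i) + cost j (a j).
    rewrite /cost; case: (b i =P 0); case: (b i =P L i); case: (b j =P 0); case: (b j =P L j); lia.
  lia.
- move=> l lS; rewrite /transfer; case: eqP => [->|_]; first by lia.
  by case: eqP => [->|_]; [lia | exact: aL].
- lia.
Qed.

End Greedy.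

(** * One fibre *)

Section Words.

Variables (T : eqType) (z : T).

Definition reduced (x : seq T) := [seq a <- x | a != z].

(** An explicit enumeration of a fibre, used to count it. *)
Fixpoint words_of (n : nat) (s : seq T) : seq (seq T) :=
  if n is n'.+1 then
    map (cons z) (words_of n' s) ++
      (if s is b :: s' then map (cons b) (words_of n' s') else [::])
  else if s is [::] then [:: [::]] else [::].

Lemma mem_map_cons (a b : T) x X :
  (a :: x \in map (cons b) X) = (a == b) && (x \in X).
Proof.
apply/mapP/andP => [[y hy [-> ->]]|[/eqP-> hx]]; first by rewrite eqxx.
by exists x.
Qed.

Lemma nil_map_cons (b : T) X : [::] \in map (cons b) X = false.
Proof. by apply/mapP => -[]. Qed.

Lemma mem_words_of n s x : z \notin s ->
  (x \in words_of n s) = (size x == n) && (reduced x == s).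
Proof.
elim: n s x => [|n IHn] s x hs /=.
  by case: s hs => [|b s] hs; case: x.
rewrite mem_cat; case: x => [|a x] /=.
  by rewrite nil_map_cons; case: s hs => // b s _; rewrite nil_map_cons.
rewrite mem_map_cons IHn // eqSS.
case: s hs => [|b s] hs.
  by rewrite orbF; case: eqP => //=; rewrite andbF.
move: hs; rewrite inE negb_or eq_sym => /andP[bz hs].
rewrite mem_map_cons IHn //; case: (eqVneq a z) => [->|az] /=.
  by rewrite [z == b]eq_sym (negPf bz) orbF.
by rewrite eqseq_cons andbCA.
Qed.

Lemma words_of_uniq n s : z \notin s -> uniq (words_of n s).
Proof.
elim: n s => [|n IHn] s hs /=; first by case: s hs.
have inj (b : T) : injective (cons b) by move=> ? ? [].
rewrite cat_uniq map_inj_uniq // IHn //=.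
case: s hs => //= b s; rewrite inE negb_or => /andP[bz hs].
rewrite map_inj_uniq // IHn // andbT; apply/hasPn => x /mapP[y _ ->].
by rewrite mem_map_cons eq_sym (negPf bz).
Qed.

Lemma size_words_of n s : size (words_of n s) = 'C(n, size s).
Proof.
elim: n s => [|n IHn] [|b s] //=; first by rewrite size_cat size_map IHn !bin0.
by rewrite size_cat !size_map !IHn binS.
Qed.

(** * Splitting a family by the first letter *)

Definition slice (a : T) (A : seq (seq T)) : seq (seq T) :=
  [seq behead x | x <- A & ohead x == Some a].

Lemma mem_slice a A x : (x \in slice a A) = (a :: x \in A).
Proof.
apply/mapP/idP => [[[|b y]]|hx]; rewrite ?mem_filter //=.
  by case/andP => /eqP[->] h ->.
by exists (a :: x) => //; rewrite mem_filter /= eqxx.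
Qed.

Lemma slice_uniq a A : uniq A -> uniq (slice a A).
Proof.
move=> hA; rewrite map_inj_in_uniq ?filter_uniq //.
by move=> [|b x] [|c y]; rewrite !mem_filter //= => /andP[/eqP[->] _] /andP[/eqP[->] _] ->.
Qed.

Lemma size_slice2 a b A : a != b -> size (slice a A) + size (slice b A) <= size A.
Proof.
move=> ab; rewrite !size_map !size_filter -(count_predC (fun x => ohead x == Some a) A).
rewrite leq_add2l; apply: sub_count => x /= /eqP->.
by apply: contraNneq ab => -[->].
Qed.

Lemma size_slices a b A : a != b ->
    {in A, forall x, (ohead x == Some a) || (ohead x == Some b)} ->
  size A = size (slice a A) + size (slice b A).
Proof.
move=> ab hA; rewrite !size_map !size_filter -(count_predC (fun x => ohead x == Some a) A).
congr (_ + _); apply: eq_in_count => x /hA /=.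
case/orP=> /eqP -> /=; rewrite !(inj_eq Some_inj) ?eqxx ?(negPf ab) //.
by rewrite eq_sym ab.
Qed.

Lemma size_slice1 a A : {in A, forall x, ohead x = Some a} -> size (slice a A) = size A.
Proof.
move=> hA; rewrite size_map; congr size; apply/all_filterP/allP => x /hA ->; exact: eqxx.
Qed.

(** * Bounds on the shadow in one fibre of words *)

Lemma reduced_nil x : reduced x = [::] -> x = nseq (size x) z.
Proof. by elim: x => //= a x IHx; case: eqP => //= -> /IHx {1}->. Qed.

Lemma ohead_reduced x b s : reduced x = b :: s ->
  (ohead x == Some z) || (ohead x == Some b).
Proof. by case: x => //= a x; case: eqP => /= [-> _|_ [-> _]]; rewrite eqxx ?orbT. Qed.

Lemma reduced_notin x : z \notin reduced x.
Proof. by rewrite mem_filter eqxx. Qed.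

Lemma size_reduced x : size (reduced x) <= size x.
Proof. by rewrite size_filter count_size. Qed.

(** [D] contains the slice of [A] at [z], by deletion of the leading zero, and its two slices
    contain the shadows of the two slices of [A]. These are the two terms of the maximum in
    [minshadow_split]. *)
Lemma minshadow_lower n s (A D : seq (seq T)) :
    uniq A ->
    {in A, forall x, size x = n /\ reduced x = s} ->
    (forall u v, u ++ z :: v \in A -> u ++ v \in D) ->
  minshadow (n - size s) (size A) <= size D.
Proof.
elim: n s A D => [|n IHn] s A D uA hA hD; first by rewrite minshadow0l.
have hq : size (slice z A) <= size D.
  apply: uniq_leq_size; first exact: slice_uniq.
  by move=> x; rewrite mem_slice; apply: (hD [::]).
case: s hA => [|b s] hA.
  rewrite -(@size_slice1 z A).
    by apply: leq_trans (minshadow_le _ _) hq.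
  by move=> x /hA[sx /reduced_nil ->]; rewrite sx.
rewrite [size (b :: s)]/= subSS.
have [A0|[x0 Ax0]] : A = [::] \/ exists x, x \in A.
  by case: A {uA hA hD hq} => [|x A]; [left | right; exists x; rewrite mem_head].
  by rewrite A0 minshadow0.
have zb : z != b.
  have [_ e] := hA _ Ax0; have := reduced_notin x0.
  by rewrite e inE negb_or => /andP[].
rewrite (size_slices zb) => [|x /hA[_ /ohead_reduced] //].
have [->|[m em]] : n - size s = 0 \/ exists m, n - size s = m.+1.
  by case: (n - size s) => [|m]; [left | right; exists m].
  by rewrite minshadow0l.
rewrite em addnC; apply: leq_trans (minshadow_split _ _ _) _.
rewrite geq_max hq /= addnC; apply: leq_trans (size_slice2 D zb).
apply: leq_add.
  rewrite (_ : m = n - (size s).+1); last by lia.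
  apply: (IHn (b :: s)); first exact: slice_uniq.
    by move=> x; rewrite mem_slice => /hA /= [[->]]; rewrite eqxx.
  by move=> u v; rewrite !mem_slice; apply: (hD (z :: u)).
rewrite -em; apply: IHn; first exact: slice_uniq.
  by move=> x; rewrite mem_slice => /hA /= [[->]]; rewrite eq_sym zb => -[].
by move=> u v; rewrite !mem_slice; apply: (hD (b :: u)).
Qed.

(* The words are reversed: colex order compares positions from the right, which
   is the left end here. *)
Lemma minshadow_upper n s (C D : seq (seq T)) :
    uniq C -> uniq D ->
    {in C, forall x, size x = n /\ reduced x = s} ->
    (forall u v v' a, a != z -> size v = size v' -> u ++ z :: v' \in C ->
       reduced (u ++ a :: v) = s -> u ++ a :: v \in C) ->
    {in D, forall y, exists u v, y = u ++ v /\ u ++ z :: v \in C} ->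
  size D <= minshadow (n - size s) (size C).
Proof.
elim: n s C D => [|n IHn] s C D uC uD hC down hD.
  case: D uD hD => // y D _ hD; have [u [v [_ /hC[]]]] := hD y (mem_head _ _).
  by rewrite size_cat addnS.
have hDw y : y \in D -> size y = n /\ reduced y = s.
  move=> /hD[u [v [-> /hC[]]]]; rewrite size_cat addnS => -[<-].
  by rewrite size_cat /reduced !filter_cat /= eqxx.
case: s hC down hDw => [|b s] hC down hDw.
  have hD1 : size D <= 1.
    apply: (@uniq_leq_size _ D [:: nseq n z]) => // y /hDw[sy /reduced_nil ->].
    by rewrite sy inE.
  case: D {uD hDw} hD hD1 => // y D hD hD1; have [u [v [_ hC1]]] := hD y (mem_head _ _).
  apply: leq_trans hD1 _; rewrite -(minshadow1 n) minshadow_mono //.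
  by case: C hC1 {uC hC down hD}.
rewrite [size (b :: s)]/= subSS.
have [C0|[x0 Cx0]] : C = [::] \/ exists x, x \in C.
  by case: C {uC hC hD down} => [|x C]; [left | right; exists x; rewrite mem_head].
  by case: D hD {uD hDw} => // y D hD; have [u [v []]] := hD y (mem_head _ _); rewrite C0.
have [zb zs] : z != b /\ z \notin s.
  have [_ e] := hC _ Cx0; have := reduced_notin x0.
  by rewrite e inE negb_or => /andP[].
have bz : b != z by rewrite eq_sym.
rewrite (size_slices zb (A := C)) => [|x /hC[_ /ohead_reduced] //].
rewrite (size_slices zb (A := D)) => [|x /hDw[_ /ohead_reduced] //].
(* If no word of [C] starts with a zero, neither does any word of [D], and everything takes place in
   the slices at [b]. *)
case: (boolP (has predT (slice z C))) => [/hasP[v' hv' _]|hn]; last first.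
  have Cz : slice z C = [::] by case: (slice z C) hn.
  have Cz' v : (z :: v \in C) = false by rewrite -mem_slice Cz.
  have -> : slice z D = [::].
    case E : (slice z D) => [//|y l]; have : y \in slice z D by rewrite E mem_head.
    rewrite mem_slice => /hD[[|c u] [v [/= e]]]; first by rewrite Cz'.
    by case: e => <- _; rewrite Cz'.
  rewrite Cz !add0n; apply: IHn; try exact: slice_uniq.
  - by move=> x; rewrite mem_slice => /hC /= [[->]]; rewrite bz => -[].
  - move=> u v v' a az sv; rewrite !mem_slice => hu e.
    by apply: (down (b :: u) v v') => //=; rewrite bz; congr (_ :: _).
  - move=> y; rewrite mem_slice => /hD[[|c u] [v [/= e]]]; first by rewrite Cz'.
    by case: e => <- -> h; exists u, v; rewrite mem_slice.
have [sv' rv'] : size v' = n /\ reduced v' = b :: s.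
  by move: hv'; rewrite mem_slice => /hC /= [[->]]; rewrite eqxx.
have hns : size s < n by have := size_reduced v'; rewrite rv' sv'.
(* One word of [C] with a leading zero forces every word with leading [b] into [C]. The slice at [b]
   is thus a full first block, to be removed by [minshadowD]. *)
pose m := n - (size s).+1.
have em : n - size s = m.+1 by rewrite /m; lia.
have full : size (slice b C) = nwords m.+1 (size s).
  rewrite /nwords -em subnK ?(ltnW hns) // -size_words_of.
  apply/eqP; rewrite eqn_leq; apply/andP; split; apply: uniq_leq_size.
  - exact: slice_uniq.
  - move=> x; rewrite mem_slice mem_words_of // => /hC /= [[->]].
    by rewrite bz => -[->]; rewrite !eqxx.
  - exact: words_of_uniq.
  - move=> x; rewrite mem_slice mem_words_of // => /andP[/eqP sx /eqP rx].
    apply: (down [::] x v'); rewrite ?sx ?sv' -?mem_slice //=.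
    by rewrite bz rx.
have hC1 : size (slice z C) <= nwords m (size s).+1.
  rewrite /nwords /m subnK // -[_.+1]/(size (b :: s)) -size_words_of.
  apply: uniq_leq_size; first exact: slice_uniq.
  move=> x; rewrite mem_slice mem_words_of ?inE ?negb_or ?zb // => /hC /= [[->]].
  by rewrite eqxx /= => ->; rewrite !eqxx.
rewrite full em [X in minshadow _ X]addnC minshadowD // addnC leq_add //.
  rewrite /nwords (_ : m + size s = n.-1) /m -?size_words_of; last by lia.
  apply: uniq_leq_size; first exact: slice_uniq.
  move=> x; rewrite mem_slice mem_words_of // => /hDw /= [<-].
  by rewrite bz => -[->]; rewrite !eqxx.
rewrite /m; apply: (IHn (b :: s)); try exact: slice_uniq.
- by move=> x; rewrite mem_slice => /hC /= [[->]]; rewrite eqxx.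
- move=> u v w a az sv; rewrite !mem_slice => hu e.
  by apply: (down (z :: u) v w) => //=; rewrite eqxx.
- move=> y; rewrite mem_slice => /hD[[|c u] [v [/= e]]].
    (* If the deleted zero was the leading one, the word in [C] begins with two zeros, and deleting
       the second gives the same result. *)
    by rewrite -e => h; exists [::], y; rewrite mem_slice.
  by case: e => <- -> h; exists u, v; rewrite mem_slice.
Qed.

End Words.

(** * The order and the shadow of tuples *)

Section Orders.

Variable k : nat.

Lemma max_symdiff_inI r (X Y : {set 'I_r}) m :
    m \in symdiff X Y -> {in symdiff X Y, forall j : 'I_r, j <= m} -> m \in Y ->
  max_symdiff_in X Y.
Proof.
move=> hm hmax mY; apply/exists_inP; exists m => //; rewrite mY andbT.
exact/forall_inP.
Qed.

Lemma max_symdiff_total r (X Y : {set 'I_r}) :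
  X != Y -> max_symdiff_in X Y || max_symdiff_in Y X.
Proof.
move=> XY; have [i0 hi0] : exists i, i \in symdiff X Y.
  apply/set0Pn; apply: contraNneq XY => e; apply/eqP/setP => i.
  have := in_set0 i; rewrite -e !inE.
  by case: (i \in X); case: (i \in Y).
have symC : symdiff Y X = symdiff X Y by rewrite /symdiff setUC.
case: (@arg_maxnP _ i0 (mem (symdiff X Y)) val hi0) => m hm hmax.
have : m \in symdiff X Y := hm.
rewrite {1}/symdiff in_setU => /orP[] /setDP[m1 m2].
  by apply/orP; right; apply: (max_symdiff_inI (m := m)); rewrite ?symC.
by apply/orP; left; apply: (max_symdiff_inI (m := m)).
Qed.

Lemma le_c_total r (u v : r.-tuple 'I_k.+1) : le_c u v || le_c v u.
Proof.
rewrite /le_c [v == u]eq_sym; case: (eqVneq u v) => [//|uv] /=.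
have [i0 hi0] : exists i, R i u != R i v.
  apply/existsP; apply: contraNT uv; rewrite negb_exists => /forallP h.
  apply/eqP/eq_from_tnth => j; have /negPn/eqP/setP/(_ j) := h (tnth u j).
  by rewrite !inE eqxx => /esym/eqP.
case: (@arg_minnP _ i0 (fun i => R i u != R i v) val hi0) => i hi hmin.
have hlt (j : 'I_k.+1) : j < i -> R j u == R j v.
  by move=> ji; apply: contraTT ji; rewrite -leqNgt; apply: hmin.
case/orP: (max_symdiff_total hi) => hm; apply/orP; [left|right];
  apply/existsP; exists i; rewrite hm andbT; apply/andP; split => //.
- by apply/forallP => j; apply/implyP/hlt.
- by rewrite eq_sym.
- by apply/forallP => j; apply/implyP => /hlt; rewrite eq_sym.
Qed.

Variable n : nat.
Implicit Types x y : n.-tuple 'I_k.+1.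

(** A free length [r] allows the equation between lengths to be substituted, so no tuple has to be
    cast. *)
Lemma re_le_cI r (u v : r.-tuple 'I_k.+1) x y :
  val u = re x -> val v = re y -> le_c u v -> re_le_c x y.
Proof.
move=> ux vy; have er : r = size (re x) by rewrite -ux size_tuple.
subst r => h; apply/existsP; exists u; apply/existsP; exists v.
by rewrite ux vy !eqxx.
Qed.

Lemma w0E x : w ord0 x = n - size (re x).
Proof.
have -> : w ord0 x = count (pred1 ord0) x.
  by rewrite /w -sum1_card -sum1_count big_tuple; apply: eq_bigl => i; rewrite inE.
by have := count_predC (pred1 ord0) x; rewrite size_tuple size_filter => /(canRL (addnK _)).
Qed.

Lemma size_re x : size (re x) <= n.
Proof. by rewrite size_filter (leq_trans (count_size _ _)) ?size_tuple. Qed.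

(** The fibre of [s] lies entirely before that of [s']. The condition on sizes says that [s] has no
    more zeros, as the exchange inequality requires. *)
Definition precedes (s s' : seq 'I_k.+1) : Prop :=
  size s' <= size s /\ forall x y, re x = s -> re y = s' -> vec_le x y.

(** Between different fibres [vec_le] depends on the reduced sequences only. *)
Lemma precedes_total x0 y0 :
  re x0 != re y0 -> precedes (re x0) (re y0) \/ precedes (re y0) (re x0).
Proof.
have lt x1 y1 : size (re x1) < size (re y1) -> precedes (re y1) (re x1).
  move=> h; split=> [|x y ex ey]; first exact: ltnW.
  rewrite /vec_le !w0E ex ey; apply/or4P; apply: Or42.
  by have := size_re y1; lia.
move=> ne; case: (ltngtP (size (re x0)) (size (re y0))) => h; [right|left|].
- exact: lt.
- exact: lt.
have [u hu] : exists u : (size (re x0)).-tuple 'I_k.+1, val u = re x0.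
  by exists (in_tuple (re x0)).
have [v hv] : exists v : (size (re x0)).-tuple 'I_k.+1, val v = re y0.
  by rewrite h; exists (in_tuple (re y0)).
case/orP: (le_c_total u v) => huv; [left|right]; split; rewrite ?h // => x y ex ey;
  apply/or4P; apply: Or43; rewrite !w0E ex ey h eqxx ?ne /=.
  by apply: re_le_cI huv; rewrite ?ex ?ey.
by rewrite eq_sym ne; apply: re_le_cI huv; rewrite ?ex ?ey.
Qed.

(** The tails agree, so the last position where the zero sets differ is [size p], and it is a zero
    of [y]. *)
Lemma vec_le_colex x y (p q t : seq 'I_k.+1) a :
    size p = size q -> a != ord0 ->
    val x = p ++ a :: t -> val y = q ++ ord0 :: t -> re x = re y ->
  vec_le x y.
Proof.
move=> spq a0 ex ey exy.
apply/or4P; apply: Or44; rewrite !w0E exy !eqxx /=; apply/orP; right.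
have pn : size p < n.
  by have := size_tuple x; rewrite -[tval x]/(val x) ex size_cat /=; lia.
have tx i : tnth x i = nth ord0 (p ++ a :: t) i by rewrite (tnth_nth ord0) -ex.
have ty i : tnth y i = nth ord0 (q ++ ord0 :: t) i by rewrite (tnth_nth ord0) -ey.
have hy : Ordinal pn \in R ord0 y.
  by rewrite inE ty nth_cat /= spq ltnn subnn.
apply: (max_symdiff_inI (m := Ordinal pn)); last exact: hy.
  by rewrite in_setU !in_setD hy !inE tx nth_cat /= ltnn subnn /= a0.
move=> j hj; rewrite leqNgt; apply/negP => /= hlt.
move: hj; rewrite !inE tx ty !nth_cat -spq ltnNge (ltnW hlt) /=.
have [d ->] : exists d, j - size p = d.+1 by exists (j - size p).-1; lia.
by rewrite /= !andNb.
Qed.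

End Orders.

(** * The shadow restricted to a fibre of tuples *)

Section Shadows.

Variables k n : nat.
Notation vec := (n.-tuple 'I_k.+1).
Implicit Types (A B : {set vec}) (s : seq 'I_k.+1).

Lemma delete_atE (T : Type) (a : T) (u v : seq T) :
  delete_at (size u) (u ++ a :: v) = u ++ v.
Proof.
by rewrite /delete_at take_size_cat // -cat_rcons -(size_rcons u a) drop_size_cat.
Qed.

Lemma shadowP A (y : n.-1.-tuple 'I_k.+1) :
  reflect (exists2 x, x \in A & exists u v, val x = u ++ ord0 :: v /\ val y = u ++ v)
          (y \in shadow A).
Proof.
rewrite inE; apply: (iffP exists_inP) => -[x xA].
  case/existsP => i /andP[/eqP xi /eqP ->]; exists x => //.
  exists (take i x), (drop i.+1 x); split=> //.
  rewrite -xi (tnth_nth ord0) -drop_nth ?size_tuple //.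
  by rewrite cat_take_drop.
case=> u [v [ex ey]]; exists x => //.
have un : size u < n.
  by have := size_tuple x; rewrite -[tval x]/(val x) ex size_cat /=; lia.
apply/existsP; exists (Ordinal un); rewrite (tnth_nth ord0) /= ey.
rewrite -[tval x]/(val x) ex delete_atE eqxx andbT.
by rewrite nth_cat ltnn subnn.
Qed.

Definition fiber m s (A : {set m.-tuple 'I_k.+1}) := [set x in A | re x == s].

Lemma mem_fiber_map m s (A : {set m.-tuple 'I_k.+1}) (t : seq 'I_k.+1) :
  reflect (exists x, [/\ x \in A, re x = s & val x = t])
          (t \in [seq val x | x <- enum (fiber s A)]).
Proof.
apply: (iffP mapP) => [[x]|[x [xA xs xt]]].
  by rewrite mem_enum inE => /andP[xA /eqP xs] ->; exists x.
by exists x => //; rewrite mem_enum inE xA xs eqxx.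
Qed.

Lemma fiber_map_uniq m s (A : {set m.-tuple 'I_k.+1}) :
  uniq [seq val x | x <- enum (fiber s A)].
Proof. by rewrite map_inj_uniq ?enum_uniq //; apply: val_inj. Qed.

Lemma size_fiber_map m s (A : {set m.-tuple 'I_k.+1}) :
  size [seq val x | x <- enum (fiber s A)] = #|fiber s A|.
Proof. by rewrite size_map -cardE. Qed.

Lemma card_fiber_le s A : ord0 \notin s -> #|fiber s A| <= 'C(n, size s).
Proof.
move=> hs; rewrite -size_fiber_map -(size_words_of ord0).
apply: uniq_leq_size (fiber_map_uniq _ _) _ => t /mem_fiber_map[x [_ xs <-]].
by rewrite mem_words_of // size_tuple eqxx -xs eqxx.
Qed.

Lemma card_fiber_full s A : ord0 \notin s ->
  (forall x : vec, re x = s -> x \in A) -> #|fiber s A| = 'C(n, size s).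
Proof.
move=> hs hA; apply/eqP; rewrite eqn_leq card_fiber_le //=.
rewrite -size_fiber_map -(size_words_of ord0).
apply: uniq_leq_size (words_of_uniq _ hs) _ => t.
rewrite mem_words_of // => /andP[st /eqP rt].
by apply/mem_fiber_map; exists (Tuple st); split=> //; apply: hA.
Qed.

Lemma fiber_shadow_lower s A :
  minshadow (n - size s) #|fiber s A| <= #|fiber s (shadow A)|.
Proof.
rewrite -!size_fiber_map; apply: (@minshadow_lower _ ord0).
- exact: fiber_map_uniq.
- by move=> t /mem_fiber_map[x [_ xs <-]]; rewrite size_tuple.
move=> u v /mem_fiber_map[x [xA xs ex]]; apply/mem_fiber_map.
have suv : size (u ++ v) == n.-1.
  have := size_tuple x; rewrite -[tval x]/(val x) ex !size_cat /=.
  by move=> <-; rewrite addnS.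
exists (Tuple suv); split=> //; first by apply/shadowP; exists x => //; exists u, v.
by rewrite -xs /re -[tval x]/(val x) ex /= !filter_cat.
Qed.

(** After reversal the common tail in [vec_le_colex] becomes a common prefix, so an initial segment
    satisfies the closure condition of [minshadow_upper]. *)
Lemma fiber_shadow_upper s B : initial_segment (@vec_le k n) B ->
  #|fiber s (shadow B)| <= minshadow (n - size s) #|fiber s B|.
Proof.
move=> hB; rewrite -!size_fiber_map -(size_rev s).
rewrite -(size_map rev) -[size [seq _ | x <- enum (fiber s B)]](size_map rev).
have mem_rev m (A : {set m.-tuple 'I_k.+1}) t :
    (t \in map rev [seq val x | x <- enum (fiber s A)]) =
    (rev t \in [seq val x | x <- enum (fiber s A)]).
  by rewrite -[t in LHS]revK mem_map //; apply: can_inj revK.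
apply: (@minshadow_upper _ ord0).
- by rewrite map_inj_uniq ?fiber_map_uniq //; apply: can_inj revK.
- by rewrite map_inj_uniq ?fiber_map_uniq //; apply: can_inj revK.
- move=> t; rewrite mem_rev => /mem_fiber_map[x [_ xs ex]].
  by rewrite -(revK t) -ex size_rev size_tuple -xs -filter_rev.
- move=> u v v' a a0 sv; rewrite !mem_rev => /mem_fiber_map[y [yB ys ey]] rs.
  have st : size (rev (u ++ a :: v)) == n.
    have := size_tuple y; rewrite -[tval y]/(val y) ey !size_rev !size_cat /= sv.
    by move=> ->.
  have xs : re (Tuple st) = s.
    by rewrite /re /= filter_rev -[[seq _ <- _ | _]]/(reduced ord0 _) rs revK.
  apply/mem_fiber_map; exists (Tuple st); split=> //.
  apply: hB yB _; apply: (@vec_le_colex _ _ _ _ (rev v) (rev v') (rev u) a) => //.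
  + by rewrite !size_rev.
  + by rewrite /= rev_cat rev_cons cat_rcons.
  + by rewrite ey rev_cat rev_cons cat_rcons.
  by rewrite ys.
move=> t; rewrite mem_rev => /mem_fiber_map[y [/shadowP[x xB [u [v [ex ey]]]] ys et]].
exists (rev v), (rev u); split; first by rewrite -rev_cat -ey et revK.
rewrite mem_rev; apply/mem_fiber_map; exists x; split=> //.
  rewrite -ys /re -[tval x]/(val x) -[tval y]/(val y) ex ey.
  by rewrite !filter_cat.
by rewrite rev_cat rev_cons !revK cat_rcons.
Qed.

End Shadows.

(** * Summation over all fibres *)

Lemma card_fibers (T : finType) (U : eqType) (f : T -> U) (S : seq U) (X : {set T}) :
    uniq S -> {in X, forall x, f x \in S} ->
  #|X| = \sum_(s <- S) #|[set x in X | f x == s]|.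
Proof.
move=> uS hX; rewrite -sum1_card.
under [RHS]eq_bigr => s _ do rewrite -sum1_card.
rewrite (eq_bigr (fun s => \sum_(x in X) (f x == s))); last first.
  move=> s _; rewrite [RHS]big_mkcond [LHS]big_mkcond /=; apply: eq_bigr => x _.
  by rewrite inE; case: (x \in X) => //=; case: (f x == s).
rewrite exchange_big /=; apply: eq_bigr => x xX.
rewrite (bigD1_seq (f x)) ?hX //= eqxx big1 ?addn0 // => s.
by rewrite eq_sym => /negPf ->.
Qed.

Theorem theorem1 (k n : nat) (hk : 0 < k) (hn : 0 < n)
  (A B : {set n.-tuple 'I_k.+1})
  (hB : initial_segment (@vec_le k n) B) (hcard : #|B| = #|A|) :
  #|shadow B| <= #|shadow A|.
Proof.
(* The reduced sequences of all vectors; they also index the fibres of a shadow, since deleting a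
   zero keeps the reduced sequence. *)
pose S := undup [seq re x | x <- enum {: n.-tuple 'I_k.+1}].
have uS : uniq S by apply: undup_uniq.
have memS (x : n.-tuple 'I_k.+1) : re x \in S.
  by rewrite mem_undup map_f // mem_enum.
have SP s : s \in S -> exists x : n.-tuple 'I_k.+1, re x = s.
  by rewrite mem_undup => /mapP[x _ ->]; exists x.
have nz s : s \in S -> ord0 \notin s by move=> /SP[x <-]; apply: reduced_notin.
have shadowS (C : {set n.-tuple 'I_k.+1}) : {in shadow C, forall y, re y \in S}.
  move=> y /shadowP[x _ [u [v [ex ey]]]]; rewrite (_ : re y = re x) //.
  by rewrite /re -[tval x]/(val x) -[tval y]/(val y) ex ey !filter_cat.
pose f (s : seq 'I_k.+1) := minshadow (n - size s).
pose L (s : seq 'I_k.+1) := 'C(n, size s).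
pose a s := #|fiber s A|; pose b s := #|fiber s B|.
apply: (@leq_trans (\sum_(s <- S) f s (b s))).
  rewrite (card_fibers uS (@shadowS B)); apply: leq_sum => s _.
  exact: fiber_shadow_upper.
apply: (@leq_trans (\sum_(s <- S) f s (a s))); last first.
  rewrite (card_fibers uS (@shadowS A)); apply: leq_sum => s _.
  exact: fiber_shadow_lower.
have in_of_pos s : 0 < b s -> exists2 x, x \in B & re x = s.
  by move=> /card_gt0P[x]; rewrite inE => /andP[xB /eqP xs]; exists x.
have out_of_lt s : s \in S -> b s < L s -> exists2 x, x \notin B & re x = s.
  move=> sS bs; case: (boolP [exists x, (x \notin B) && (re x == s)]).
    by case/existsP => x /andP[xB /eqP xs]; exists x.
  rewrite negb_exists => /forallP h; move: bs.
  rewrite /b card_fiber_full ?ltnn ?nz // => x xs.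
  by have := h x; rewrite xs eqxx andbT negbK.
(* A fibre that is not full cannot precede one that meets [B]: a missing vector of the former would
   lie below a member of the initial segment. *)
have not_precedes s s' : s \in S -> precedes n s s' -> b s < L s -> 0 < b s' -> False.
  move=> sS [_ h] /(out_of_lt _ sS)[x xB xs] /in_of_pos[y yB ys].
  by move/negP: xB; apply; apply: hB yB (h _ _ xs ys).
have total s s' : s \in S -> s' \in S -> s != s' -> precedes n s s' \/ precedes n s' s.
  by move=> /SP[x <-] /SP[y <-]; apply: precedes_total.
have bL s : s \in S -> b s <= L s by move=> /nz; apply: card_fiber_le.
apply: (greedy_sum_min uS (L := L)) => //.
- move=> s s' sS sS' ne /andP[b0 bl]; case: (total _ _ sS sS' ne) => h.
    by left; apply/eqP; rewrite -leqn0 leqNgt; apply/negP; apply: not_precedes h bl.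
  right; apply/eqP; rewrite eqn_leq bL //= leqNgt; apply/negP => bl'.
  exact: not_precedes h bl' b0.
(* Since [s] meets [B] and [s'] is not full, [s] must precede [s'] and has no more zeros, so the
   exchange goes in the favourable direction. *)
- move=> s s' sS sS' ne b0 bl x y.
  case: (total _ _ sS sS' ne) => h; last by case: (not_precedes _ _ sS' h bl b0).
  have sn : size s <= n by have [x0 <-] := SP _ sS; apply: size_re.
  have sn' : size s' <= n by have [x0 <-] := SP _ sS'; apply: size_re.
  have [ss _] := h.
  have LE r : size r <= n -> L r = nwords (n - size r) (size r).
    by move=> hr; rewrite /nwords subnK.
  rewrite !LE // => hx hy; apply: (@minshadow_exchange _ _ _ (size s')); rewrite ?subnK //.
  exact: leq_sub2l.
- by move=> s /nz; apply: card_fiber_le.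
- by rewrite -!card_fibers.
Qed.
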